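(* Consider $x(t+1)=Ax(t)+Bu(t)$ with block-diagonal $K$, $A_K=A+BK$, $M\in\mathbb N$, constraint sets $\mathcal X=\{x:H_xx\le h_x\}$, $\mathcal U=\{u:H_uu\le h_u\}$ with all components of $h_x,h_u$ positive, and the ellipsoid $\Omega(Q)=\{x:x^\top Q^{-1}x\le1\}$ with $Q\succ0$. Suppose $$A_K^MQ(A_K^M)^\top\preceq Q,$$ $$H_{x,k}A_K^rQ(A_K^r)^\top H_{x,k}^\top\le h_{x,k}^2,\quad r=0,\dots,M,$$ $$H_{u,k}KA_K^rQ(A_K^r)^\top K^\top H_{u,k}^\top\le h_{u,k}^2,\quad r=0,\dots,M-1,$$ for every row $H_{x,k}$ of $H_x$ and $H_{u,k}$ of $H_u$. Then $q(\xi)=(K\xi,KA_K\xi,\dots,KA_K^{M-1}\xi)$ is an admissible finite-step feedback control law on $\Omega(Q)$, and $A_K^Mx\in\Omega(Q)$ for every $x\in\Omega(Q)$. Moreover, $\|A_K^rx\|\le\|A_K^r\|_2\|x\|$ for $r=0,\dots,M$, which verifies the boundedness requirement in the definition of admissibility. For fixed $K$ and $M$, the displayed conditions are linear matrix inequalities or scalar linear inequalities in $Q$.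
   Context: $x=(x_1,\dots,x_\ell)$, $u=(u_1,\dots,u_\ell)$, $A=[A_{ij}]$, $B=\operatorname{blkdiag}(B_1,\dots,B_\ell)$, $K=\operatorname{blkdiag}(K_1,\dots,K_\ell)$. The trajectory under $q$ is $x(l,\xi,q)=A_K^l\xi$, $l=0,\dots,M$. Admissible finite-step feedback law of length $M$ on $\Omega(Q)$ means: $q$ maps $\Omega(Q)$ into $\mathcal U^M$, and for every $l=1,\dots,M$, $x(l,\xi,q)\in\mathcal X$ for all $\xi\in\Omega(Q)$ and there is $\kappa_l\in\mathcal K$ (continuous, strictly increasing, zero at zero) with $\|x(l,\xi,q)\|\le\kappa_l(\|\xi\|)$ for all $\xi\in\Omega(Q)$. $\|\cdot\|$ is the Euclidean norm, $\|\cdot\|_2$ the induced norm, $\preceq$ the Loewner order. *)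

(* Defs.v *)
From HB Require Import structures.
From mathcomp Require Import all_boot all_order all_algebra.
From mathcomp Require Import all_classical all_reals all_analysis.

Set Implicit Arguments.
Unset Strict Implicit.
Unset Printing Implicit Defensive.

Import Order.TTheory GRing.Theory Num.Theory.
Import numFieldNormedType.Exports.

Local Open Scope classical_set_scope.
Local Open Scope ring_scope.

(* \mxdiag only accepts square blocks; the conform_mx only serves to give the
   block (i, i) the type expected at position (i, j) when i == j. *)
Definition blkdiag (R : realType) (ell : nat) (p q : 'I_ell -> nat)
    (D : forall i, 'M[R]_(p i, q i)) : 'M[R]_(\sum_i p i, \sum_i q i) :=
  \mxblock_(i < ell, j < ell) (if i == j then conform_mx 0 (D i) else 0).

(* The library norm `|x| of a column vector is the max norm. *)
Definition enorm (R : realType) (n : nat) (x : 'cV[R]_n) : R :=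
  Num.sqrt (\sum_(i < n) x i 0 ^+ 2).

Definition opnorm2 (R : realType) (m n : nat) (G : 'M[R]_(m, n)) : R :=
  sup [set enorm (G *m x) | x in [set x : 'cV[R]_n | enorm x <= 1]].

Definition posdef (R : realType) (n : nat) (Q : 'M[R]_n) : Prop :=
  Q^T = Q /\ forall x : 'cV[R]_n, x != 0 -> 0 < (x^T *m Q *m x) 0 0.

Definition possemidef (R : realType) (n : nat) (Q : 'M[R]_n) : Prop :=
  Q^T = Q /\ forall x : 'cV[R]_n, 0 <= (x^T *m Q *m x) 0 0.

Definition loewner_le (R : realType) (n : nat) (P Q : 'M[R]_n) : Prop :=
  possemidef (Q - P).

Definition polyhedron (R : realType) (p n : nat) (H : 'M[R]_(p, n))
    (h : 'cV[R]_p) : set 'cV[R]_n :=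
  [set x | forall k, (H *m x) k 0 <= h k 0].

Definition ellipsoid (R : realType) (n : nat) (Q : 'M[R]_n) : set 'cV[R]_n :=
  [set x | (x^T *m invmx Q *m x) 0 0 <= 1].

(* Class K: only the values on [0, +oo[ matter. *)
Definition class_K (R : realType) (kappa : R -> R) : Prop :=
  [/\ {within `[0, +oo[, continuous kappa},
      (forall s t, 0 <= s -> s < t -> kappa s < kappa t)
    & kappa 0 = 0].

(* State at time l of x(t+1) = A x(t) + B u(t), x(0) = xi, under the input
   sequence us; meaningful for l <= size us. *)
Fixpoint trajectory (R : realType) (n m : nat) (A : 'M[R]_n) (B : 'M[R]_(n, m))
    (us : seq 'cV[R]_m) (xi : 'cV[R]_n) (l : nat) : 'cV[R]_n :=
  if l is t.+1 then A *m trajectory A B us xi t + B *m us`_t else xi.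

(* Only the restriction of q to Omega is constrained. *)
Definition admissible (R : realType) (n m M : nat) (A : 'M[R]_n)
    (B : 'M[R]_(n, m)) (X : set 'cV[R]_n) (U : set 'cV[R]_m)
    (Omega : set 'cV[R]_n) (q : 'cV[R]_n -> M.-tuple 'cV[R]_m) : Prop :=
  (forall xi, Omega xi -> forall t : 'I_M, U (tnth (q xi) t)) /\
  (forall l : nat, (1 <= l <= M)%N ->
     (forall xi, Omega xi -> X (trajectory A B (q xi) xi l)) /\
     exists kappa : R -> R, class_K kappa /\
       forall xi, Omega xi ->
         enorm (trajectory A B (q xi) xi l) <= kappa (enorm xi)).

(* The inequality L(Q) <= G(Q) in the Loewner order is a linear matrix
   inequality in the symmetric unknown Q: it reads 0 <= F0 + F(Q) with F0
   symmetric and F linear and symmetric-valued. *)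
Definition is_LMI (R : realType) (n p : nat) (L G : 'M[R]_n -> 'M[R]_p) : Prop :=
  exists (F0 : 'M[R]_p) (F : {linear 'M[R]_n -> 'M[R]_p}),
    [/\ F0^T = F0,
        (forall Q, Q^T = Q -> (F Q)^T = F Q)
      & forall Q, Q^T = Q -> G Q - L Q = F0 + F Q].

(* Likewise L(Q) <= G(Q) between scalars reads 0 <= c + f(Q). *)
Definition is_scalar_linear_ineq (R : realType) (n : nat)
    (L G : 'M[R]_n -> R) : Prop :=
  exists (c : R) (f : {scalar 'M[R]_n}),
    forall Q, Q^T = Q -> G Q - L Q = c + f Q.

Definition terminal_lhs (R : realType) (n M : nat) (AK Q : 'M[R]_n) : 'M[R]_n :=
  AK ^+ M *m Q *m (AK ^+ M)^T.

Definition state_lhs (R : realType) (n r : nat) (AK : 'M[R]_n) (H : 'rV[R]_n)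
    (Q : 'M[R]_n) : R :=
  (H *m AK ^+ r *m Q *m (AK ^+ r)^T *m H^T) 0 0.

Definition input_lhs (R : realType) (n m r : nat) (AK : 'M[R]_n)
    (K : 'M[R]_(m, n)) (H : 'rV[R]_m) (Q : 'M[R]_n) : R :=
  (H *m K *m AK ^+ r *m Q *m (AK ^+ r)^T *m K^T *m H^T) 0 0.

(* Main.v *)
(* Write x in Omega(Q) as x = Q w with w^T Q w <= 1.  Expanding the
   nonnegative form (t w - a^T)^T Q (t w - a^T) gives
   2 t (a x) <= t^2 (w^T Q w) + a Q a^T for every row a and real t.
   With a = H A_K^r and t = h > 0 this is constraint satisfaction
   (a Q a^T <= h^2 forces a x <= h); with a = y^T Q^-1 A_K^M, y = A_K^M x and
   t = 1 it is invariance of Omega(Q). *)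
Require Import Defs.
From HB Require Import structures.
From mathcomp Require Import all_boot all_order all_algebra.
From mathcomp Require Import all_classical all_reals all_analysis.
From mathcomp Require Import lra.

Set Implicit Arguments.
Unset Strict Implicit.

Import Order.TTheory GRing.Theory Num.Theory.
Import numFieldNormedType.Exports.

Local Open Scope classical_set_scope.
Local Open Scope ring_scope.

(** A row v in the left kernel of Q gives v Q v^T = 0, which definiteness allows only for v = 0. *)
Lemma posdef_unitmx (R : realType) (n : nat) (Q : 'M[R]_n) :
  posdef Q -> Q \in unitmx.
Proof.
move=> [QT Qpos]; rewrite -row_free_unit -kermx_eq0; apply/eqP/row_matrixP => i.
rewrite row0; set v := row i _.
have vQ : v *m Q = 0 by apply/sub_kermxP; rewrite row_sub.
apply/eqP; apply: contraT => v_neq0.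
have := Qpos v^T; rewrite trmxK vQ mul0mx mxE ltxx.
by rewrite -(inj_eq trmx_inj) trmxK trmx0; apply.
Qed.

Lemma posdef_ge0 (R : realType) (n : nat) (Q : 'M[R]_n) (x : 'cV[R]_n) :
  posdef Q -> 0 <= (x^T *m Q *m x) 0 0.
Proof.
move=> [_ Qpos]; have [->|x_neq0] := eqVneq x 0; first by rewrite mulmx0 mxE.
by rewrite ltW // Qpos.
Qed.

Lemma ellipsoid_support (R : realType) (n : nat) (Q : 'M[R]_n)
    (a : 'rV[R]_n) (x : 'cV[R]_n) (t : R) :
  posdef Q ->
  2 * t * (a *m x) 0 0 <=
    t ^+ 2 * (x^T *m invmx Q *m x) 0 0 + (a *m Q *m a^T) 0 0.
Proof.
move=> Qpd; have Qu := posdef_unitmx Qpd; have [QT _] := Qpd.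
set w := invmx Q *m x; have Qw : Q *m w = x by rewrite mulKVmx.
have wQ : w^T *m Q = x^T by rewrite -{1}QT -trmx_mul Qw.
have xa : x^T *m a^T = a *m x.
  by rewrite -trmx_mul; apply/matrixP => i j; rewrite !ord1 mxE.
(* Both cross terms of the expansion reduce to [a *m x]: one through w^T Q = x^T, the other through
   Q w = x. *)
have := posdef_ge0 (t *: w - a^T) Qpd.
rewrite !linearB !linearZ /= trmxK !mulmxBl -!scalemxAl wQ xa.
rewrite -(mulmxA a Q w) Qw -(mulmxA x^T _ x) -/w.
move: (a *m x) (a *m Q *m a^T) (x^T *m w) => ax aQa xw.
by rewrite !mxE; lra.
Qed.

Lemma ellipsoid_halfspace (R : realType) (n : nat) (Q : 'M[R]_n)
    (a : 'rV[R]_n) (x : 'cV[R]_n) (h : R) :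
  posdef Q -> 0 < h -> (a *m Q *m a^T) 0 0 <= h ^+ 2 -> ellipsoid Q x ->
  (a *m x) 0 0 <= h.
Proof.
rewrite /ellipsoid /= => Qpd h_gt0 aQa xQx.
have := ellipsoid_support a x h Qpd.
have : h ^+ 2 * (x^T *m invmx Q *m x) 0 0 <= h ^+ 2 by rewrite ler_piMr ?sqr_ge0.
(* Together the bounds read 2 h (a x) <= h^2 + h^2; positivity of h permits cancelling it. *)
move=> le1 le2; rewrite -(ler_pM2l h_gt0); lra.
Qed.

(** Put y = G x and s = y^T Q^-1 y. The Loewner inequality tested at Q^-1 y bounds a Q a^T by s for
    a = y^T Q^-1 G, while a x = s. Hence 2 s <= x^T Q^-1 x + s, so s <= 1. *)
Lemma ellipsoid_invariant (R : realType) (n : nat) (Q G : 'M[R]_n)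
    (x : 'cV[R]_n) :
  posdef Q -> loewner_le (G *m Q *m G^T) Q -> ellipsoid Q x ->
  ellipsoid Q (G *m x).
Proof.
rewrite /ellipsoid /= => Qpd [_ GQG] xQx; have Qu := posdef_unitmx Qpd.
have [QT _] := Qpd.
(* An opaque y cannot be split back into [G *m x] by the later [trmx_mul] and [mulmxA]. *)
have [y Gx] : exists y, y = G *m x by exists (G *m x).
have := ellipsoid_support (y^T *m invmx Q *m G) x 1 Qpd.
rewrite -mulmxA -Gx.
have := GQG (invmx Q *m y).
rewrite !trmx_mul trmxK trmx_inv QT mulmxBr mulmxBl mulmxKV // !mulmxA.
move: (_ *m invmx Q *m y) (_ *m invmx Q *m y) (_ *m invmx Q *m x) xQx => yGy yQy xQx.
by rewrite !mxE; lra.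
Qed.

Lemma enorm_ge0 (R : realType) (n : nat) (x : 'cV[R]_n) : 0 <= enorm x.
Proof. exact: sqrtr_ge0. Qed.

Lemma enorm0 (R : realType) (n : nat) : enorm (0 : 'cV[R]_n) = 0.
Proof. by rewrite /enorm big1 ?sqrtr0 // => i _; rewrite mxE expr0n. Qed.

Lemma enormZ (R : realType) (n : nat) (c : R) (x : 'cV[R]_n) :
  enorm (c *: x) = `|c| * enorm x.
Proof.
rewrite /enorm -sqrtr_sqr -sqrtrM ?sqr_ge0 // mulr_sumr.
by congr Num.sqrt; apply: eq_bigr => i _; rewrite mxE exprMn.
Qed.

Lemma ler_norm_enorm (R : realType) (n : nat) (x : 'cV[R]_n) (i : 'I_n) :
  `|x i 0| <= enorm x.
Proof.
rewrite -sqrtr_sqr ler_wsqrtr // (bigD1 i) //= lerDl.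
by apply: sumr_ge0 => j _; exact: sqr_ge0.
Qed.

Lemma enorm_eq0 (R : realType) (n : nat) (x : 'cV[R]_n) :
  enorm x = 0 -> x = 0.
Proof.
move=> x0; apply/matrixP => i j; rewrite ord1 mxE; apply/eqP.
by rewrite -normr_le0 -x0 ler_norm_enorm.
Qed.

(** Needed before [sup] can be used as an upper bound. On the unit ball every entry of x has modulus
    at most 1, so entry i of G x is at most the l1 norm of row i; the witness is the Euclidean norm
    of these row norms. *)
Lemma opnorm2_has_ubound (R : realType) (m n : nat) (G : 'M[R]_(m, n)) :
  has_ubound [set enorm (G *m x) | x in [set x : 'cV[R]_n | enorm x <= 1]].
Proof.
exists (Num.sqrt (\sum_i (\sum_j `|G i j|) ^+ 2)) => _ [x /= x_le1 <-].
rewrite ler_wsqrtr //; apply: ler_sum => i _; rewrite -[leLHS]real_normK ?num_real //.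
rewrite lerXn2r ?nnegrE ?sumr_ge0 // mxE (le_trans (ler_norm_sum _ _ _)) //.
apply: ler_sum => j _; rewrite normrM ler_piMr //.
exact: le_trans (ler_norm_enorm x j) x_le1.
Qed.

Lemma opnorm2_ge0 (R : realType) (m n : nat) (G : 'M[R]_(m, n)) :
  0 <= opnorm2 G.
Proof.
apply: (ub_le_sup (opnorm2_has_ubound G)); exists 0 => /=.
  by rewrite enorm0.
by rewrite mulmx0 enorm0.
Qed.

(** By homogeneity: for nonzero x, the vector x / |x| lies in the unit ball over which the supremum
    is taken. *)
Lemma enorm_mulmx_le (R : realType) (m n : nat) (G : 'M[R]_(m, n))
    (x : 'cV[R]_n) :
  enorm (G *m x) <= opnorm2 G * enorm x.
Proof.
have [x0|x_neq0] := eqVneq (enorm x) 0.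
  by rewrite x0 (enorm_eq0 x0) mulmx0 enorm0 mulr0.
have x_gt0 : 0 < enorm x by rewrite lt0r x_neq0 enorm_ge0.
rewrite -ler_pdivrMr //; apply: (ub_le_sup (opnorm2_has_ubound G)).
have nV : `|(enorm x)^-1| = (enorm x)^-1 by rewrite ger0_norm ?invr_ge0 ?enorm_ge0.
exists ((enorm x)^-1 *: x) => /=; first by rewrite enormZ nV mulVf.
by rewrite -scalemxAr enormZ nV mulrC.
Qed.

Lemma class_K_linear (R : realType) (c : R) :
  0 < c -> class_K (fun s : R => c * s).
Proof.
move=> c_gt0; split=> [|s t _ st|]; last by rewrite mulr0.
  by apply: continuous_subspaceT => s; exact: mulrl_continuous.
by rewrite ltr_pM2l.
Qed.

Lemma trajectory_feedback (R : realType) (n m M : nat) (A : 'M[R]_n)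
    (B : 'M[R]_(n, m)) (K : 'M[R]_(m, n)) (xi : 'cV[R]_n) (l : nat) :
  (l <= M)%N ->
  trajectory A B [tuple K *m (A + B *m K) ^+ t *m xi | t < M] xi l =
  (A + B *m K) ^+ l *m xi.
Proof.
elim: l => [|l IHl] lM /=; first by rewrite expr0 mul1mx.
rewrite IHl 1?ltnW //.
(* The input applied at time l is entry l of the tuple. As l < M, neither the default 0 of the
   sequence nor the default [Ordinal lM] of the enumeration is returned for being out of range. *)
have -> : [seq K *m (A + B *m K) ^+ (t : 'I_M) *m xi | t <- enum 'I_M]`_l =
    K *m (A + B *m K) ^+ l *m xi.
  by rewrite (nth_map (Ordinal lM)) ?size_enum_ord // nth_enum_ord.
by rewrite exprS -[_ * _]/(_ *m _) -(mulmxA (A + _)) mulmxDl !mulmxA.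
Qed.

Lemma is_LMI_terminal (R : realType) (n M : nat) (AK : 'M[R]_n) :
  is_LMI (terminal_lhs M AK) (fun Q => Q).
Proof.
pose F Q := Q - terminal_lhs M AK Q.
have F_linear : linear F.
  move=> c P Q; rewrite /F /terminal_lhs mulmxDr mulmxDl -scalemxAr -scalemxAl.
  by rewrite scalerBr opprD addrACA.
pose HF := GRing.isLinear.Build _ _ _ _ F F_linear.
pose Flin : {linear 'M[R]_n -> 'M[R]_n} := HB.pack F HF.
(* The inequality is homogeneous in Q, so the constant term is 0. *)
exists 0, Flin; split=> [|Q QT|Q QT]; [exact: trmx0| |by rewrite add0r].
by rewrite /= /F /terminal_lhs linearB /= !trmx_mul trmxK QT mulmxA.
Qed.

(** Serves state and input constraints alike: an entry of U Q V is linear in Q once U and V are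
    fixed, and c is the constant term. *)
Lemma is_scalar_linear_ineq_quad (R : realType) (n p : nat) (U : 'M[R]_(p, n))
    (V : 'M[R]_(n, p)) (i j : 'I_p) (L : 'M[R]_n -> R) (c : R) :
  (forall Q, L Q = (U *m Q *m V) i j) -> is_scalar_linear_ineq L (fun=> c).
Proof.
move=> LE.
pose f Q : R := - (U *m Q *m V) i j.
have f_scalar : scalar f.
  move=> a P Q; rewrite /f mulmxDr mulmxDl -scalemxAr -scalemxAl !mxE.
  by rewrite opprD mulrN.
pose Hf := GRing.isLinear.Build _ _ _ _ f f_scalar.
pose flin : {scalar 'M[R]_n} := HB.pack f Hf.
by exists c, flin => Q _; rewrite LE.
Qed.

(** Brings the constraint to the form a Q a^T with a = H A_K^r, as [ellipsoid_halfspace] expects;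
    [input_lhsE] does so with a = H K A_K^r. *)
Lemma state_lhsE (R : realType) (n r : nat) (AK : 'M[R]_n) (H : 'rV[R]_n)
    (Q : 'M[R]_n) :
  state_lhs r AK H Q = ((H *m AK ^+ r) *m Q *m (H *m AK ^+ r)^T) 0 0.
Proof. by rewrite /state_lhs trmx_mul !mulmxA. Qed.

Lemma input_lhsE (R : realType) (n m r : nat) (AK : 'M[R]_n)
    (K : 'M[R]_(m, n)) (H : 'rV[R]_m) (Q : 'M[R]_n) :
  input_lhs r AK K H Q =
  ((H *m K *m AK ^+ r) *m Q *m (H *m K *m AK ^+ r)^T) 0 0.
Proof. by rewrite /input_lhs !trmx_mul !mulmxA. Qed.

Unset Implicit Arguments.
Set Strict Implicit.

Theorem proposition7 (R : realType) (ell : nat) (n m : 'I_ell -> nat)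
    (Ab : forall i j : 'I_ell, 'M[R]_(n i, n j))
    (Bb : forall i : 'I_ell, 'M[R]_(n i, m i))
    (Kb : forall i : 'I_ell, 'M[R]_(m i, n i))
    (M px pu : nat)
    (Hx : 'M[R]_(px, \sum_i n i)) (hx : 'cV[R]_px)
    (Hu : 'M[R]_(pu, \sum_i m i)) (hu : 'cV[R]_pu)
    (hx_gt0 : forall k, 0 < hx k 0) (hu_gt0 : forall k, 0 < hu k 0) :
  let A : 'M[R]_(\sum_i n i) := \mxblock_(i < ell, j < ell) Ab i j in
  let B : 'M[R]_(\sum_i n i, \sum_i m i) := blkdiag Bb in
  let K : 'M[R]_(\sum_i m i, \sum_i n i) := blkdiag Kb in
  let AK : 'M[R]_(\sum_i n i) := A + B *m K in
  (forall Q : 'M[R]_(\sum_i n i),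
     posdef Q ->
     loewner_le (terminal_lhs M AK Q) Q ->
     (forall (k : 'I_px) (r : nat), (r <= M)%N ->
        state_lhs r AK (row k Hx) Q <= hx k 0 ^+ 2) ->
     (forall (k : 'I_pu) (r : nat), (r < M)%N ->
        input_lhs r AK K (row k Hu) Q <= hu k 0 ^+ 2) ->
     [/\ admissible A B (polyhedron Hx hx) (polyhedron Hu hu) (ellipsoid Q)
           (fun xi => [tuple K *m AK ^+ t *m xi | t < M]),
         (forall x, ellipsoid Q x -> ellipsoid Q (AK ^+ M *m x))
       & forall (r : nat) (x : 'cV[R]_(\sum_i n i)), (r <= M)%N ->
           enorm (AK ^+ r *m x) <= opnorm2 (AK ^+ r) * enorm x]) /\
  [/\ is_LMI (terminal_lhs M AK) (fun Q => Q),
      (forall (k : 'I_px) (r : nat), (r <= M)%N ->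
         is_scalar_linear_ineq (state_lhs r AK (row k Hx))
           (fun _ => hx k 0 ^+ 2))
    & forall (k : 'I_pu) (r : nat), (r < M)%N ->
         is_scalar_linear_ineq (input_lhs r AK K (row k Hu))
           (fun _ => hu k 0 ^+ 2)].
Proof.
move=> A B K AK; split; last first.
  split=> [|k r _|k r _]; first exact: is_LMI_terminal.
    exact/is_scalar_linear_ineq_quad/state_lhsE.
  exact/is_scalar_linear_ineq_quad/input_lhsE.
move=> Q Qpd termQ stateQ inputQ; split; last first.
- by move=> r x _; exact: enorm_mulmx_le.
- by move=> x; exact: ellipsoid_invariant.
split=> [xi xiQ t k|l /andP[_ lM]].
  rewrite tnth_mktuple.
  have := inputQ k t (ltn_ord t); rewrite input_lhsE => inQ.
  have := ellipsoid_halfspace Qpd (hu_gt0 k) inQ xiQ.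
  (* Row k of Hu times a vector is entry k of the product, the quantity bounded in [polyhedron]. *)
  by rewrite -!mulmxA -row_mul mxE.
split=> [xi xiQ k|].
  rewrite trajectory_feedback //.
  have := stateQ k l lM; rewrite state_lhsE => inQ.
  have := ellipsoid_halfspace Qpd (hx_gt0 k) inQ xiQ.
  by rewrite -mulmxA -row_mul mxE.
(* The induced norm vanishes when A_K^l = 0; adding 1 makes the slope positive, hence the function
   strictly increasing. *)
exists (fun s => (opnorm2 (AK ^+ l) + 1) * s); split.
  by apply: class_K_linear; rewrite ltr_wpDl ?opnorm2_ge0.
move=> xi _; rewrite trajectory_feedback //.
by rewrite (le_trans (enorm_mulmx_le _ _)) // ler_wpM2r ?enorm_ge0 // lerDl.
Qed.
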